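(* Let $\frac13<\sigma<\frac12$ and define $f_\sigma:\mathbb R\to\mathbb R$ by $f_\sigma(x)=e^{-x^2}\sum_{m=1}^\infty 5^{-m}m^{-\sigma}\cos(5^m x)$. Then $f_\sigma$ does not have the $(1,1)$-$N$-property, i.e. there exists a set $E\subset\mathbb R$ with $\mathcal H^1(E)=0$ and $\mathcal H^1(f_\sigma(E))>0$.
   Context: $\mathcal H^1$ denotes one-dimensional Hausdorff (equivalently Lebesgue) measure on $\mathbb R$. *)

(* Defs.v *)
From HB Require Import structures.
From mathcomp Require Import all_boot all_order all_algebra.
From mathcomp Require Import all_classical all_reals all_analysis.
Set Implicit Arguments. Unset Strict Implicit. Unset Printing Implicit Defensive.
Import Order.TTheory GRing.Theory Num.Theory.
Import numFieldNormedType.Exports.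
Local Open Scope classical_set_scope.
Local Open Scope ring_scope.
Local Open Scope big_scope.

(* One-dimensional Hausdorff measure on R = Lebesgue outer measure:
   the infimum of the Lebesgue measures of measurable supersets. *)
Definition H1 {R : realType} (E : set R) : \bar R :=
  ereal_inf [set (@lebesgue_measure R A) | A in
     [set A : set (measurableTypeR R) | measurable A /\ E `<=` A]].

Definition f_sigma {R : realType} (sigma : R) (x : R) : R :=
  expR (- x ^+ 2) *
  (\big[+%R/0%R]_(1 <= m <oo) ((5%:R ^+ m)^-1 * (m%:R `^ (- sigma)) * cos (5%:R ^+ m * x))).

(* Main.v *)
Require Import Defs.
From HB Require Import structures.
From mathcomp Require Import all_boot all_order all_algebra.
From mathcomp Require Import all_classical all_reals all_analysis.
From mathcomp Require Import measurable_realfun.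
From mathcomp Require Import ring lra zify.
Import Order.TTheory GRing.Theory Num.Theory.
Import numFieldNormedType.Exports.
Local Open Scope classical_set_scope.
Local Open Scope ring_scope.

(* Write [f x = exp (- x^2) * W x] with [W] the lacunary cosine series, and
   take for [E] the strict record points of [f] on [-1, 0]: the [x] such that
   [f t < f x] for all [-1 <= t < x].  The first point where [f] reaches a
   level between [f (-1)] and [f 0] is a record, so [f @` E] contains a
   nontrivial interval.

   Comparing [f x] with [f (x - 5^-n)] at a record [x] bounds the partial sums
   [S_n x = sum_(m <= n) m^-sigma sin (5^m x)] from above for all large [n].
   Since [sigma < 1/2], the coefficients of [S_n] are not square summable.  On
   an interval of length [2 pi 5^-j], [S_n - S_j] has vanishing first and third
   moments, variance [V / 2] with [V] tending to infinity, and fourth moment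
   at most [V^2]; so it exceeds [sqrt V / 8] on a fixed proportion of the
   interval.  Hence the set where [S_n] stays bounded above has no density
   point, and [E] is Lebesgue null. *)

(** * Continuity of trigonometric expressions and multiple-angle formulas *)

Section trigonometric_moments.
Context {R : realType}.
Local Notation mu := (@lebesgue_measure R).
Implicit Types (f g : R -> R) (c : R).

Lemma continuous_cosM c p : continuous (fun x : R => cos (c * x + p)).
Proof.
move=> x; apply: continuous_comp; last exact: continuous_cos.
by apply: cvgD; [apply: cvgM; [exact: cvg_cst|exact: cvg_id]|exact: cvg_cst].
Qed.

Lemma continuous_sinM c : continuous (fun x : R => sin (c * x)).
Proof.
move=> x; apply: continuous_comp; last exact: continuous_sin.
by apply: cvgM; [exact: cvg_cst|exact: cvg_id].
Qed.

Lemma continuous_mulfun f g :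
  continuous f -> continuous g -> continuous (fun x => f x * g x).
Proof. by move=> cf cg x; apply: cvgM; [exact: cf|exact: cg]. Qed.

Lemma continuous_addfun f g :
  continuous f -> continuous g -> continuous (fun x => f x + g x).
Proof. by move=> cf cg x; apply: cvgD; [exact: cf|exact: cg]. Qed.

Lemma continuous_scalefun c f : continuous f -> continuous (fun x => c * f x).
Proof. by move=> cf; apply: continuous_mulfun => // x; exact: cvg_cst. Qed.

Lemma continuous_expfun f n : continuous f -> continuous (fun x => f x ^+ n).
Proof.
move=> cf; elim: n => [|n IH].
  by under eq_fun do rewrite expr0; move=> x; exact: cvg_cst.
by under eq_fun do rewrite exprS; exact: continuous_mulfun.
Qed.

Lemma integrable_continuous_itv f a b :
  continuous f -> mu.-integrable `[a, b] (EFin \o f).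
Proof.
move=> cf; apply: continuous_compact_integrable; first exact: segment_compact.
exact: continuous_subspaceT.
Qed.

Lemma cos_double_sin (t : R) : cos (2 * t) = 1 - 2 * sin t ^+ 2.
Proof.
rewrite (_ : 2 * t = t + t); last by ring.
by rewrite cosD; have := cos2Dsin2 t; nra.
Qed.

Lemma sin_triple (t : R) : sin (3 * t) = 3 * sin t - 4 * sin t ^+ 3.
Proof.
rewrite (_ : 3 * t = 2 * t + t); last by ring.
rewrite sinD cos_double_sin (_ : 2 * t = t + t); last by ring.
rewrite sinD (_ : _ * cos t = 2 * sin t * cos t ^+ 2); last by ring.
by rewrite (_ : cos t ^+ 2 = 1 - sin t ^+ 2); [ring|have := cos2Dsin2 t; lra].
Qed.

Lemma cos_quadruple (t : R) :
  cos (4 * t) = 1 - 8 * sin t ^+ 2 + 8 * sin t ^+ 4.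
Proof.
rewrite (_ : 4 * t = 2 * (2 * t)); last by ring.
rewrite cos_double_sin (_ : 2 * t = t + t); last by ring.
rewrite sinD (_ : _ ^+ 2 = 4 * sin t ^+ 2 * cos t ^+ 2); last by ring.
by rewrite (_ : cos t ^+ 2 = 1 - sin t ^+ 2); [ring|have := cos2Dsin2 t; lra].
Qed.

(** * Fourier bands over one period *)

Variables a w : R.
Hypothesis w0 : 0 < w.
Let I := `[a, a + 2 * pi / w]%classic : set R.
Local Notation E f := (Rintegral mu I f).

Let period_gt0 : 0 < 2 * pi / w.
Proof. by rewrite divr_gt0// mulr_gt0// pi_gt0. Qed.

Let mI : measurable I. Proof. exact: measurable_itv. Qed.

Let ED f g : continuous f -> continuous g ->
  E (fun x => f x + g x) = E f + E g.
Proof.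
by move=> cf cg; apply: RintegralD => //; exact: integrable_continuous_itv.
Qed.

Let EZ c f : continuous f -> E (fun x => c * f x) = c * E f.
Proof.
by move=> cf; apply: RintegralZl => //; exact: integrable_continuous_itv.
Qed.

Lemma integral_cos_period (i : nat) (p : R) : (0 < i)%N ->
  E (fun x => cos (i%:R * w * x + p)) = 0.
Proof.
move=> i0; have iw0 : i%:R * w != 0 by rewrite mulf_neq0 ?gt_eqF ?ltr0n.
pose F x : R := (i%:R * w)^-1 * sin (i%:R * w * x + p).
have dF (x : R) : is_derive x 1 F (cos (i%:R * w * x + p)).
  apply: is_derive_eq.
  by rewrite addr0 /GRing.scale/= mulr1 mulrC mulfK.
rewrite /Rintegral (@continuous_FTC2 _ (fun x => cos (i%:R * w * x + p)) F)//.
- rewrite -EFinB/= /F.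
  have -> : i%:R * w * (a + 2 * pi / w) + p
            = i%:R * w * a + p + (pi *+ 2) *+ i.
    by rewrite -mulr_natr; field; rewrite gt_eqF.
  by rewrite (periodicn (@sinD2pi R)) subrr.
- by rewrite ltrDl.
- exact: (continuous_subspaceT (continuous_cosM _ _)).
- have cF : continuous F.
    by move=> x; apply/differentiable_continuous/derivable1_diffP; case: (dF x).
  split=> [x _| |]; first by case: (dF x).
    exact/cvg_at_right_filter/cF.
  exact/cvg_at_left_filter/cF.
- by move=> x _; rewrite derive1E; apply: derive_val.
Qed.

(* [band N g]: no Fourier mode of [g] has order [N] or more on the period [I]. *)
Definition band (N : nat) (g : R -> R) := continuous g /\
  forall (i : nat) (p : R), (N <= i)%N ->
    E (fun x => g x * cos (i%:R * w * x + p)) = 0.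

Lemma band_widen N M g : (N <= M)%N -> band N g -> band M g.
Proof.
by move=> NM [cg gN]; split=> // i p Mi; apply: gN; exact: leq_trans Mi.
Qed.

Lemma bandD N f g : band N f -> band N g -> band N (fun x => f x + g x).
Proof.
move=> [cf fN] [cg gN]; split; first exact: continuous_addfun.
move=> i p Ni; under eq_Rintegral do rewrite mulrDl.
rewrite ED ?fN ?gN ?addr0//;
  by apply: continuous_mulfun => //; exact: continuous_cosM.
Qed.

Lemma bandZ N c f : band N f -> band N (fun x => c * f x).
Proof.
move=> [cf fN]; split; first exact: continuous_scalefun.
move=> i p Ni; under eq_Rintegral do rewrite -mulrA.
rewrite EZ ?fN ?mulr0//.
by apply: continuous_mulfun => //; exact: continuous_cosM.
Qed.

Lemma band_cst : band 1 (cst 1).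
Proof.
split; first exact: cst_continuous.
move=> i p i0; under eq_Rintegral do rewrite mul1r.
exact: integral_cos_period.
Qed.

(** Product-to-sum turns the test mode [i] into the modes [i - m] and [i + m], both of order at
    least [N] once [N + m <= i]; the free phase in [band] absorbs [q]. *)
Lemma bandM_cos N m q g : band N g ->
  band (N + m) (fun x => g x * cos (m%:R * w * x + q)).
Proof.
move=> [cg gN]; split.
  by apply: continuous_mulfun => //; exact: continuous_cosM.
move=> i p Nmi.
have mi : (m <= i)%N by apply: leq_trans Nmi; exact: leq_addl.
transitivity (E (fun x => 2^-1 * (g x * cos ((i - m)%N%:R * w * x + (p - q)))
                 + 2^-1 * (g x * cos ((i + m)%N%:R * w * x + (p + q))))).
  apply: eq_Rintegral => x _; rewrite natrB// natrD.
  have -> : (i%:R - m%:R) * w * x + (p - q)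
    = (i%:R * w * x + p) - (m%:R * w * x + q) by ring.
  have -> : (i%:R + m%:R) * w * x + (p + q)
    = (i%:R * w * x + p) + (m%:R * w * x + q) by ring.
  by rewrite (cosB _ (_ + q)) (cosD (_ + p)); field.
have cgc k r : continuous (fun x => g x * cos (k * w * x + r)).
  by apply: continuous_mulfun => //; exact: continuous_cosM.
rewrite ED ?EZ ?gN ?mulr0 ?addr0//; try lia;
  exact: continuous_scalefun.
Qed.

Lemma bandM_sin N m g : band N g ->
  band (N + m) (fun x => g x * sin (m%:R * w * x)).
Proof. by under eq_fun do rewrite -cosBpihalf; exact: bandM_cos. Qed.

Lemma band_sin0 N m g : band N g -> (N <= m)%N ->
  E (fun x => g x * sin (m%:R * w * x)) = 0.
Proof.
move=> [_ gN] Nm.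
under eq_Rintegral do rewrite -cosBpihalf.
exact: gN.
Qed.

Lemma band_cos0 N m g : band N g -> (N <= m)%N ->
  E (fun x => g x * cos (m%:R * w * x)) = 0.
Proof.
move=> [_ gN] Nm.
under eq_Rintegral do rewrite -[X in cos X]addr0.
exact: gN.
Qed.

(** * Lacunary sine sums and their first four moments *)

Variable c : nat -> R.

Definition lacunary_sum n x :=
  \sum_(i < n) c i * sin ((5 ^ i.+1)%N%:R * w * x).
Local Notation T := lacunary_sum.

Lemma lacunary_sumS n x :
  T n.+1 x = T n x + c n * sin ((5 ^ n.+1)%N%:R * w * x).
Proof. by rewrite /T big_ord_recr. Qed.

Lemma continuous_lacunary_sum n : continuous (T n).
Proof.
elim: n => [|n IH].
  rewrite (_ : T 0 = cst 0); first exact: cst_continuous.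
  by apply/funext => x; rewrite /T big_ord0.
rewrite (_ : T n.+1 = fun x => T n x + c n * sin ((5 ^ n.+1)%N%:R * w * x)).
  apply: continuous_addfun => //; apply: continuous_scalefun.
  exact: continuous_sinM.
by apply/funext => x; rewrite lacunary_sumS.
Qed.

Lemma bandM_lacunary_sum N n g : band N g ->
  band (N + 5 ^ n) (fun x => g x * T n x).
Proof.
move=> gN; elim: n => [|n IH].
  rewrite (_ : (fun _ => _) = fun x => 0 * g x).
    by apply: bandZ; apply: band_widen gN; exact: leq_addr.
  by apply/funext => x; rewrite /T big_ord0 mulr0 mul0r.
rewrite (_ : (fun _ => _) = fun x => g x * T n x
    + c n * (g x * sin ((5 ^ n.+1)%N%:R * w * x))); last first.
  by apply/funext => x; rewrite lacunary_sumS; ring.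
apply: bandD; last by apply: bandZ; exact: bandM_sin.
by apply: band_widen IH; rewrite leq_add2l leq_exp2l.
Qed.

(** Each factor [T n] has modes up to [5 ^ n] and raises the band by that much; the leading 1 is the
    band of the constant function. *)
Lemma band_lacunary_sumX n k : band (1 + k * 5 ^ n) (fun x => T n x ^+ k).
Proof.
elim: k => [|k IH].
  by under eq_fun do rewrite expr0; exact: band_cst.
under eq_fun do rewrite exprSr.
by rewrite mulSn [(5 ^ n + _)%N]addnC addnA; exact: bandM_lacunary_sum.
Qed.

(** The error terms of the moment computations. Continuity is kept with the zero mean because
    splitting integrals requires integrability. *)
Definition vanishing (h : R -> R) := continuous h /\ E h = 0.

Lemma vanishingD f g :
  vanishing f -> vanishing g -> vanishing (fun x => f x + g x).
Proof.
move=> [cf f0] [cg g0]; split; first exact: continuous_addfun.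
by rewrite ED// f0 g0 addr0.
Qed.

Lemma vanishingZ k f : vanishing f -> vanishing (fun x => k * f x).
Proof.
move=> [cf f0]; split; first exact: continuous_scalefun.
by rewrite EZ// f0 mulr0.
Qed.

Lemma eq_mod_vanishing f g h : continuous g -> vanishing h ->
  (forall x, f x = g x + h x) -> E f = E g.
Proof.
move=> cg [ch h0] fE; under eq_Rintegral do rewrite fE.
by rewrite ED// h0 addr0.
Qed.

(** The frequency ratio 5 acts here: [1 + k * 5 ^ n <= 5 ^ n.+1] for [k <= 3], so the new frequency
    and its multiples lie outside the band of [T n ^+ k]. *)
Lemma vanishing_sin n m k : (k <= 3)%N -> (5 ^ n.+1 <= m)%N ->
  vanishing (fun x => T n x ^+ k * sin (m%:R * w * x)).
Proof.
move=> k3 nm; split.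
  apply: continuous_mulfun (continuous_sinM _).
  exact: continuous_expfun (continuous_lacunary_sum _).
apply: band_sin0 (band_lacunary_sumX n k) _.
apply: leq_trans nm; rewrite expnS; have := expn_gt0 5 n; nia.
Qed.

Lemma vanishing_cos n m k : (k <= 3)%N -> (5 ^ n.+1 <= m)%N ->
  vanishing (fun x => T n x ^+ k * cos (m%:R * w * x)).
Proof.
move=> k3 nm; split.
  under eq_fun do rewrite -[X in cos X]addr0.
  apply: continuous_mulfun (continuous_cosM _ _).
  exact: continuous_expfun (continuous_lacunary_sum _).
apply: band_cos0 (band_lacunary_sumX n k) _.
apply: leq_trans nm; rewrite expnS; have := expn_gt0 5 n; nia.
Qed.

Let L := 2 * pi / w.
Local Notation V n := (\sum_(i < n) c i ^+ 2).

Let cT n k : continuous (fun x => T n x ^+ k).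
Proof. exact: continuous_expfun (continuous_lacunary_sum _). Qed.

Let cos2E n x : cos ((2 * 5 ^ n.+1)%N%:R * w * x) =
  1 - 2 * sin ((5 ^ n.+1)%N%:R * w * x) ^+ 2.
Proof. by rewrite -cos_double_sin natrM; congr cos; ring. Qed.

Let sin3E n x : sin ((3 * 5 ^ n.+1)%N%:R * w * x) =
  3 * sin ((5 ^ n.+1)%N%:R * w * x) - 4 * sin ((5 ^ n.+1)%N%:R * w * x) ^+ 3.
Proof. by rewrite -sin_triple natrM; congr sin; ring. Qed.

Let cos4E n x : cos ((4 * 5 ^ n.+1)%N%:R * w * x) =
  1 - 8 * sin ((5 ^ n.+1)%N%:R * w * x) ^+ 2
    + 8 * sin ((5 ^ n.+1)%N%:R * w * x) ^+ 4.
Proof. by rewrite -cos_quadruple natrM; congr cos; ring. Qed.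

Let E0 k : E (fun x => T 0 x ^+ k.+1) = 0.
Proof.
under eq_Rintegral do rewrite /T big_ord0 expr0n/=.
by rewrite Rintegral_cst// mul0r.
Qed.

Let Ecst k : E (fun=> k) = k * L.
Proof.
rewrite Rintegral_cst//= /I lebesgue_measure_itv/= lte_fin ltrDl period_gt0/=.
by rewrite addrAC subrr add0r.
Qed.

Lemma lacunary_moment1 n : E (fun x => T n x ^+ 1) = 0.
Proof.
elim: n => [|n <-]; first exact: E0.
apply: (@eq_mod_vanishing _ _
  (fun x => c n * (T n x ^+ 0 * sin ((5 ^ n.+1)%N%:R * w * x)))) => //.
  by apply: vanishingZ; exact: vanishing_sin.
by move=> x; rewrite lacunary_sumS; ring.
Qed.

(** Each new term adds its mean square [c n ^+ 2 / 2]; the cross term and the cosine of the doubled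
    frequency integrate to zero. *)
Lemma lacunary_moment2 n : E (fun x => T n x ^+ 2) = V n / 2 * L.
Proof.
elim: n => [|n IH]; first by rewrite E0 big_ord0 !mul0r.
transitivity (E (fun x => T n x ^+ 2 + c n ^+ 2 / 2)).
  apply: (@eq_mod_vanishing _ _
    (fun x => 2 * c n * (T n x ^+ 1 * sin ((5 ^ n.+1)%N%:R * w * x))
       + - (c n ^+ 2 / 2) * (T n x ^+ 0 * cos ((2 * 5 ^ n.+1)%N%:R * w * x)))).
  - by apply: continuous_addfun => // x; exact: cvg_cst.
  - by apply: vanishingD; apply: vanishingZ;
      [exact: vanishing_sin|apply: vanishing_cos => //; lia].
  - by move=> x; rewrite lacunary_sumS cos2E; field.
rewrite ED//; last exact: cst_continuous.
by rewrite IH Ecst big_ord_recr/=; ring.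
Qed.

(** Averaging the square of the new sine leaves [3 / 2 * c n ^+ 2 * T n], which has mean zero by the
    first moment. *)
Lemma lacunary_moment3 n : E (fun x => T n x ^+ 3) = 0.
Proof.
elim: n => [|n <-]; first exact: E0.
transitivity (E (fun x => T n x ^+ 3 + 3 / 2 * c n ^+ 2 * T n x ^+ 1)).
  apply: (@eq_mod_vanishing _ _
    (fun x => 3 * c n * (T n x ^+ 2 * sin ((5 ^ n.+1)%N%:R * w * x))
      + (- (3 / 2 * c n ^+ 2)
          * (T n x ^+ 1 * cos ((2 * 5 ^ n.+1)%N%:R * w * x))
      + (3 / 4 * c n ^+ 3 * (T n x ^+ 0 * sin ((5 ^ n.+1)%N%:R * w * x))
      + - (c n ^+ 3 / 4)
          * (T n x ^+ 0 * sin ((3 * 5 ^ n.+1)%N%:R * w * x)))))).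
  - by apply: continuous_addfun => //; exact: continuous_scalefun.
  - by do ?apply: vanishingD; apply: vanishingZ;
      first [apply: vanishing_sin => //; lia|apply: vanishing_cos => //; lia].
  - by move=> x; rewrite lacunary_sumS cos2E sin3E; field.
rewrite ED// ?EZ//; last exact: continuous_scalefun.
by rewrite lacunary_moment1 mulr0 addr0.
Qed.

(** On average the new term contributes [3 * c n ^+ 2 * T n ^+ 2 + 3 / 8 * c n ^+ 4], where 3/8 is
    the mean of the fourth power of sine; the second moment closes the recurrence. *)
Lemma lacunary_moment4 n : E (fun x => T n x ^+ 4) <= V n ^+ 2 * L.
Proof.
elim: n => [|n IH]; first by rewrite E0 big_ord0 expr0n/= mul0r.
have -> : E (fun x => T n.+1 x ^+ 4) =
    E (fun x => T n x ^+ 4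
      + (3 * c n ^+ 2 * T n x ^+ 2 + 3 / 8 * c n ^+ 4)).
  apply: (@eq_mod_vanishing _ _
    (fun x => 4 * c n * (T n x ^+ 3 * sin ((5 ^ n.+1)%N%:R * w * x))
      + (- (3 * c n ^+ 2) * (T n x ^+ 2 * cos ((2 * 5 ^ n.+1)%N%:R * w * x))
      + (3 * c n ^+ 3 * (T n x ^+ 1 * sin ((5 ^ n.+1)%N%:R * w * x))
      + (- c n ^+ 3 * (T n x ^+ 1 * sin ((3 * 5 ^ n.+1)%N%:R * w * x))
      + (- (c n ^+ 4 / 2) * (T n x ^+ 0 * cos ((2 * 5 ^ n.+1)%N%:R * w * x))
      + c n ^+ 4 / 8
          * (T n x ^+ 0 * cos ((4 * 5 ^ n.+1)%N%:R * w * x)))))))).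
  - apply: continuous_addfun => //; apply: continuous_addfun.
      exact: continuous_scalefun.
    by move=> x; exact: cvg_cst.
  - by do ?apply: vanishingD; apply: vanishingZ;
      first [apply: vanishing_sin => //; lia|apply: vanishing_cos => //; lia].
  - by move=> x; rewrite lacunary_sumS cos2E sin3E cos4E; field.
have cc : continuous (fun _ : R => 3 / 8 * c n ^+ 4) by move=> x; exact: cvg_cst.
have cs : continuous (fun x => 3 * c n ^+ 2 * T n x ^+ 2).
  exact: continuous_scalefun.
rewrite ED//; last exact: continuous_addfun.
rewrite ED// EZ// lacunary_moment2 Ecst.
rewrite big_ord_recr/=.
have V0 : 0 <= V n by apply: sumr_ge0 => i _; exact: sqr_ge0.
have L0 : 0 <= L by exact: ltW.
have c0 : 0 <= c n ^+ 2 by exact: sqr_ge0.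
rewrite (_ : c n ^+ 4 = (c n ^+ 2) ^+ 2); last by rewrite -exprM.
move: (c n ^+ 2) c0 => d d0.
(* With [d] for [c n ^+ 2], this is [L] times the excess of [(V n + d) ^+ 2] over [V n ^+ 2 + 3 / 2
   * d * V n + 3 / 8 * d ^+ 2]. *)
have : 0 <= (d * V n / 2 + 5 / 8 * d ^+ 2) * L.
  by rewrite mulr_ge0// addr_ge0 ?mulr_ge0 ?sqr_ge0//.
by nra.
Qed.

End trigonometric_moments.

(** * Anticoncentration of lacunary sums on one period *)

Section anticoncentration.
Context {R : realType}.
Local Notation mu := (@lebesgue_measure R).

(* [t (t + 1)^2], nonpositive for [t <= 0], minus a quartic term bounding it
   above.  Its mean is at least [1/2] when [t] has first, second and third
   moments [0], [1/2], [0] and fourth moment at most [1]. *)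
Definition test_quartic (t : R) := t ^+ 3 + 2 * t ^+ 2 + t - t ^+ 4 / 2.

Lemma test_quartic_le16 t : test_quartic t <= 16.
Proof.
rewrite /test_quartic.
have := sqr_ge0 (t ^+ 2 - t - 2); have := sqr_ge0 (t - 2).
have := sqr_ge0 (t ^+ 2 - t - 5).
have := sqr_ge0 (t-3).
nra.
Qed.

(** For [t <= 1 / 8] the cubic part is at most [81 / 512], and the quartic term only lowers it. *)
Lemma test_quartic_le4V t : t <= 8^-1 -> test_quartic t <= 4^-1.
Proof.
move=> t8; rewrite /test_quartic.
have [t0|t0] := leP t 0.
  have := sqr_ge0 (t + 1); have := sqr_ge0 (t ^+ 2); nra.
have := sqr_ge0 (t + 1); have := sqr_ge0 (t ^+ 2); nra.
Qed.

(** The test quartic of [T / sqrt V] has mean at least 1/2, while it is at most 1/4 on [A] and at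
    most 16 elsewhere. Hence [L / 2 <= 16 * L - 63 / 4 * m], that is [m <= 62 / 63 * L]. *)
Lemma lacunary_sublevel_measure (a w : R) (c : nat -> R) n (A : set R) :
  0 < w -> 0 < \sum_(i < n) c i ^+ 2 -> measurable A ->
  (forall x, A x ->
    lacunary_sum w c n x <= Num.sqrt (\sum_(i < n) c i ^+ 2) / 8) ->
  (mu (A `&` `[a, (a + 2 * pi / w)%R]) <= (62 / 63 * (2 * pi / w))%:E)%E.
Proof.
move=> w0; set V := \sum_(i < n) _ => V0 mA AT.
set L := 2 * pi / w; set I := `[a, _]%classic.
have L0 : 0 < L by rewrite divr_gt0// mulr_gt0// pi_gt0.
have mI : measurable I by exact: measurable_itv.
have muI : mu I = L%:E.
  rewrite /I lebesgue_measure_itv/= lte_fin ltrDl L0.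
  by rewrite -EFinB addrAC subrr add0r.
have muA : mu (A `&` I) \is a fin_num.
  rewrite ge0_fin_numE//; apply: (@le_lt_trans _ _ (mu I)).
    by apply: le_measure; rewrite ?inE//; exact: measurableI.
  by rewrite muI ltry.
rewrite -(fineK muA) lee_fin; set m := fine _.
pose v := Num.sqrt V.
have v0 : 0 < v by rewrite sqrtr_gt0.
have vV : v ^+ 2 = V by rewrite sqr_sqrtr// ltW.
pose T := lacunary_sum w c n.
have cT k : continuous (fun x => T x ^+ k).
  exact: continuous_expfun (continuous_lacunary_sum _ _ _).
pose q x := test_quartic (T x / v).
have cqT k d : continuous (fun x => d * T x ^+ k).
  exact: continuous_scalefun.
have qE : q = fun x => (v ^- 3 * T x ^+ 3 + (2 / v ^+ 2) * T x ^+ 2)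
    + (v^-1 * T x ^+ 1 + (- (v ^- 4 / 2)) * T x ^+ 4).
  by apply/funext => x; rewrite /q /test_quartic; field; rewrite gt_eqF.
have cq : continuous q.
  rewrite qE; apply: continuous_addfun; exact: continuous_addfun.
have iq := integrable_continuous_itv _ a (a + L) cq.
have Eq : L / 2 <= Rintegral mu I q.
  have ii f : continuous f -> mu.-integrable I (EFin \o f).
    exact: integrable_continuous_itv.
  rewrite qE RintegralD//; [|by apply: ii; exact: continuous_addfun..].
  rewrite !RintegralD//; [|exact: ii..].
  rewrite !RintegralZl//; [|exact: ii..].
  rewrite lacunary_moment1// lacunary_moment2// lacunary_moment3//.
  have := lacunary_moment4 a w w0 c n.
  rewrite -/V -/L -/I -/T -vV.
  set M4 := Rintegral _ _ _ => M4le.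
  have : v ^- 4 * M4 <= L.
    by rewrite mulrC ler_pdivrMr ?exprn_gt0// mulrC (_ : 4%N = (2 * 2)%N)// exprM.
  rewrite (_ : 2 / v ^+ 2 * (v ^+ 2 / 2 * L) = L); last first.
    by field; rewrite gt_eqF.
  lra.
have iA : mu.-integrable I (EFin \o \1_A).
  apply/integrableP; split.
    by apply/measurable_EFinP; apply: measurable_indic.
  rewrite [X in (X < _)%E](_ : _ = mu (A `&` I)); first by rewrite -ge0_fin_numE.
  rewrite -integral_indic//; apply: eq_integral => t _ /=.
  by rewrite ger0_norm.
have ic k : mu.-integrable I (EFin \o (fun=> k)).
  apply: integrable_continuous_itv => x; exact: cvg_cst.
have iZA : mu.-integrable I (EFin \o (fun x => 63 / 4 * \1_A x)).
  rewrite (_ : _ \o _ = fun x => ((63 / 4)%:E * (EFin \o \1_A) x)%E).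
    exact: integrableZl.
  by apply/funext => x; rewrite /= EFinM.
have : Rintegral mu I q <= Rintegral mu I (fun x => 16 - 63 / 4 * \1_A x).
  apply: le_Rintegral => //.
    pose r (x : R) : R := 63 / 4 * \1_A x.
    rewrite (_ : _ \o _ = (EFin \o (fun=> (16 : R)%R)) \- (EFin \o r))%E.
      exact: integrableB.
    by apply/funext => x; rewrite /= EFinB.
  move=> x Ix; rewrite /q indicE.
  have [/set_mem xA|xA] := boolP (x \in A).
    rewrite mulr1 (_ : 16 - 63 / 4 = 4^-1); last by field.
    apply: test_quartic_le4V; rewrite ler_pdivrMr// mulrC.
    exact: AT.
  by rewrite mulr0 subr0; exact: test_quartic_le16.
suff -> : Rintegral mu I (fun x => 16 - 63 / 4 * \1_A x) = 16 * L - 63 / 4 * m.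
  by move: Eq; lra.
rewrite RintegralB// RintegralZl// Rintegral_cst//.
congr (_ * _ - _ * _); first exact: (congr1 fine muI).
by rewrite /Rintegral integral_indic.
Qed.

End anticoncentration.

(** * Lebesgue density and sets where lacunary sums stay bounded above *)

Section null_sets.
Context {R : realType}.
Local Notation mu := (@lebesgue_measure R).

(** Almost every point of [A] is a density point; a relative measure at most [theta < 1] at
    arbitrarily small radii forbids this, so [A] lies in the exceptional null set. *)
Lemma negligible_of_gaps (A : set R) (theta : R) : measurable A -> theta < 1 ->
  (forall x (d : R), A x -> 0 < d ->
    exists2 r, 0 < r < d & (mu (A `&` ball x r) <= (theta * (r *+ 2))%:E)%E) ->
  mu.-negligible A.
Proof.
move=> mA theta1 gaps.
apply: negligibleS (lebesgue_density mA) => x Ax /= dens.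
move: dens; rewrite indicE mem_set// => /fine_cvgP[_] /cvgrPdist_lt.
move=> /(_ (1 - theta)); rewrite subr_gt0 => /(_ theta1)[d /= d0 near_d].
have [r /andP[r0 rd] le_r] := gaps x d Ax d0.
have := near_d r; rewrite /= sub0r normrN gtr0_norm// => /(_ rd r0).
rewrite ltNge => /negP; apply.
have r20 : 0 < r *+ 2 by rewrite mulrn_wgt0.
have Afin : mu (A `&` ball x r) \is a fin_num.
  by rewrite ge0_fin_numE// (le_lt_trans le_r)// ltry.
move: le_r; rewrite -(fineK Afin) lee_fin => le_r.
rewrite lebesgue_measure_ball ?(ltW r0)// inver gt_eqF// -EFinM/=.
apply: le_trans _ (ler_norm _); rewrite lerD2l lerN2 ler_pdivrMr//.
Qed.

(** The tail is again a lacunary sum, with base frequency [5 ^+ j], so the moment bounds apply to it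
    on intervals of length [2 * pi / 5 ^+ j]. *)
Lemma lacunary_sumD (c : nat -> R) j n x :
  lacunary_sum 1 c (j + n) x =
  lacunary_sum 1 c j x + lacunary_sum (5 ^+ j) (fun i => c (j + i)%N) n x.
Proof.
rewrite /lacunary_sum big_split_ord/=; congr (_ + _).
apply: eq_bigr => i _; congr (_ * sin _).
by rewrite mulr1 -addnS expnD natrM natrX; ring.
Qed.

Lemma lacunary_bounded_above_negligible (c : nat -> R) (k : nat) (M : R) :
  ~ cvgn (series (fun i => c i ^+ 2)) ->
  mu.-negligible [set x | forall n, (k <= n)%N -> lacunary_sum 1 c n x <= M].
Proof.
move=> dvg; set A := [set _ | _].
have mA : measurable A.
  rewrite (_ : A = \bigcap_(n in [set n | (k <= n)%N])
    (lacunary_sum 1 c n @^-1` [set` `]-oo, M]])); last first.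
    apply/seteqP; split => x Ax n kn /=; first by rewrite in_itv/= Ax.
    by have := Ax n kn; rewrite /= in_itv.
  apply: bigcap_measurable => [|n _]; first by exists k => /=.
  rewrite -[X in measurable X]setTI.
  by apply: (continuous_measurable_fun (continuous_lacunary_sum 1 c n)).
apply: (@negligible_of_gaps _ (62 / 63)) => //; first by lra.
move=> x d _ d0.
(* A ball of radius [pi / 5 ^+ j] spans exactly one period of the tail after the first [j] terms. *)
have [j jd] : exists j : nat, pi / 5 ^+ j < d.
  exists (Num.bound (pi / d)).
  rewrite ltr_pdivrMr ?exprn_gt0// mulrC -ltr_pdivrMr//.
  have pd0 : 0 <= pi / d by rewrite divr_ge0 ?pi_ge0// ltW.
  apply: lt_trans (archi_boundP pd0) _.
  by rewrite -natrX ltr_nat ltn_expl.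
exists (pi / 5 ^+ j); first by rewrite jd divr_gt0 ?pi_gt0 ?exprn_gt0.
pose w : R := 5 ^+ j.
have w0 : 0 < w by rewrite exprn_gt0.
have E2 : (pi / 5 ^+ j) *+ 2 = 2 * pi / w by rewrite -mulr_natl mulrA.
rewrite E2.
pose V n := \sum_(i < n) c (j + i)%N ^+ 2.
(* [K] bounds the tail from above on [A], since the first [j] terms are controlled by the sum of
   [|c i|]; divergence then yields [n >= k] with [8 * K < sqrt (V n)]. *)
pose K := M + \sum_(i < j) `|c i|.
have [n [kn Vn]] : exists n, (k <= n)%N /\ (8 * `|K| + 1) ^+ 2 <= V n.
  have nd : nondecreasing_seq (series (fun i => c i ^+ 2)).
    by apply: nondecreasing_series => i _ _; exact: sqr_ge0.
  have /cvgryPge/(_ ((8 * `|K| + 1) ^+ 2 + series (fun i => c i ^+ 2) j)) :=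
    nondecreasing_dvgn_lt nd dvg.
  move=> [N _ leN].
  exists (maxn k N); rewrite leq_maxl; split => //.
  have Nj : (N <= j + maxn k N)%N.
    by rewrite (leq_trans (leq_maxr k N))// leq_addl.
  move: (leN _ Nj); rewrite /= !seriesEord/= big_split_ord/= -/(V _).
  by lra.
have K0 : 0 < 8 * `|K| + 1 by rewrite ltr_wpDl// mulr_ge0.
apply: le_trans (@lacunary_sublevel_measure R (x - pi / w) w (fun i => c (j + i)%N) n A w0 _ mA _).
- apply: le_measure; rewrite ?inE.
  + by apply: measurableI => //; exact: measurable_ball.
  + by apply: measurableI => //; exact: measurable_itv.
  + apply: setIS => y; rewrite /= -ball_normE /ball_/= in_itv/=.
    rewrite ltr_norml -/w => /andP[? ?].
    have -> : x - pi / w + 2 * pi / w = x + pi / w by ring.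
    by apply/andP; split; lra.
- by apply: lt_le_trans Vn; rewrite exprn_gt0.
- move=> y Ay.
  have := Ay (j + n)%N; rewrite lacunary_sumD => /(_ (leq_trans kn (leq_addl _ _))).
  have : - lacunary_sum 1 c j y <= \sum_(i < j) `|c i|.
    rewrite /lacunary_sum -sumrN; apply: ler_sum => i _.
    apply: le_trans (ler_norm _) _; rewrite normrN normrM ler_piMr//.
    by rewrite ler_norml sin_geN1 sin_le1.
  have : 8 * `|K| + 1 <= Num.sqrt (V n).
    by rewrite -[leLHS](gtr0_norm K0) -sqrtr_sqr ler_wsqrtr.
  have := ler_norm K; rewrite /K /V -/w.
  lra.
Qed.

End null_sets.

(** * The Weierstrass series: tails, continuity, backward increments *)

Section weierstrass_function.
Context {R : realType}.
Implicit Types x y h : R.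

Lemma sin_sub_le (x h : R) : 0 <= h -> sin x - sin (x - h) <= h.
Proof.
rewrite le_eqVlt => /predU1P[<-|h0]; first by rewrite subr0 subrr.
have [||z _ ->] := @MVT R sin cos (x - h) x _ (fun y _ => is_derive_sin y).
- by rewrite ltrBlDr ltrDl.
- exact/continuous_subspaceT/continuous_sin.
by rewrite opprB addrC subrK ler_piMl ?cos_le1// ltW.
Qed.

Lemma cos_taylor2 (x h : R) : 0 <= h ->
  cos x + h * sin x - h ^+ 2 / 2 <= cos (x - h).
Proof.
rewrite le_eqVlt => /predU1P[<-|h0].
  by rewrite subr0 mul0r expr0n/= mul0r addr0 subr0.
(* The Lipschitz bound on sine gives [g' t >= 0] for [t > 0], and [g h >= g 0] is the claim. *)
pose g t : R := cos (x - t) - t * sin x + t ^+ 2 / 2.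
pose g' t : R := sin (x - t) - sin x + t.
have dg (t : R) : is_derive t 1 g (g' t).
  apply: is_derive_eq.
  by rewrite /g' /GRing.scale/= !mulr0; field.
have cg : continuous g.
  by move=> t; apply/differentiable_continuous/derivable1_diffP; case: (dg t).
have [z /[!in_itv]/= /andP[z0 _] gE] :=
  @MVT R g g' 0 h h0 (fun y _ => dg y) (continuous_subspaceT cg).
have : 0 <= g h - g 0.
  rewrite gE subr0 mulr_ge0 ?(ltW h0)// /g'.
  by have := sin_sub_le x z (ltW z0); lra.
by rewrite /g subr0 mul0r expr0n/= mul0r; lra.
Qed.

Variable b : nat -> R.
Hypothesis b01 : forall m, 0 <= b m <= 1.

(** The range starts at 1 and stops before [n], as in [f_sigma], so that the limit agrees with its
    series by conversion; [weierstrass_sum n.+1] carries the modes 1 to [n]. *)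
Definition weierstrass_sum n x :=
  \sum_(1 <= m < n) ((5 ^+ m)^-1 * b m * cos (5 ^+ m * x)).
Definition weierstrass x := limn (fun n => weierstrass_sum n x).
Local Notation P := weierstrass_sum.
Local Notation W := weierstrass.

Let pow5V_gt0 n : 0 < (5 ^+ n)^-1 :> R.
Proof. by rewrite invr_gt0 exprn_gt0. Qed.

Let term_le m x : `|(5 ^+ m)^-1 * b m * cos (5 ^+ m * x)| <= (5 ^+ m)^-1.
Proof.
have /andP[b0 b1] := b01 m.
rewrite -mulrA normrM (gtr0_norm (pow5V_gt0 m)) ler_piMr ?(ltW (pow5V_gt0 m))//.
rewrite normrM (ger0_norm b0) mulr_ile1// ler_norml.
by rewrite cos_geN1 cos_le1.
Qed.

(** Keeping the subtracted term makes the induction exact: passing from [k] to [k.+1] raises the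
    bound by [(5 ^+ (n + k))^-1], the bound on the added term. *)
Let P_tail n k x : (0 < n)%N ->
  `|P (n + k) x - P n x| <= 5 / 4 * ((5 ^+ n)^-1 - (5 ^+ (n + k))^-1).
Proof.
move=> n0; elim: k => [|k IH]; first by rewrite addn0 !subrr normr0 mulr0.
rewrite addnS /P big_nat_recr/= ?addn_gt0 ?n0// -/(P (n + k) x) -/(P n x).
rewrite addrAC; apply: le_trans (ler_normD _ _) _.
have := term_le (n + k) x.
rewrite exprS invfM; lra.
Qed.

Lemma weierstrass_cvg x : cvgn (fun n => P n x).
Proof.
rewrite /P (is_cvg_series_restrict 1 (fun m => (5 ^+ m)^-1 * b m * cos (5 ^+ m * x))).
apply: normed_cvg.
apply: (@series_le_cvg _ _ (geometric 1 5^-1)) => [n|n|n|].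
- exact: normr_ge0.
- by rewrite /= mul1r exprn_ge0.
- by rewrite /= mul1r exprVn; exact: term_le.
- by apply: is_cvg_geometric_series; rewrite ger0_norm//; lra.
Qed.

Lemma weierstrass_tail n x : (0 < n)%N ->
  `|W x - P n x| <= 5 / 4 * (5 ^+ n)^-1.
Proof.
move=> n0.
have cv : `|P N x - P n x| @[N --> \oo] --> `|W x - P n x|.
  apply: cvg_norm; apply: cvgB; last exact: cvg_cst.
  exact: weierstrass_cvg.
apply: (cvgr_to_le cv); exists n => // N /= nN.
rewrite -(subnKC nN); apply: le_trans (P_tail _ _ _ n0) _.
by have := pow5V_gt0 (n + (N - n)); lra.
Qed.

Lemma weierstrass_le14 x : `|W x| <= 4^-1.
Proof.
have := weierstrass_tail 1 x isT.
by rewrite /P big_geq// subr0 expr1; lra.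
Qed.

Lemma continuous_weierstrass : continuous W.
Proof.
move=> x; apply/cvgrPdist_lt => e e0.
have [n en] : exists n : nat, 5 / 4 * (5 ^+ n.+1)^-1 < e / 4.
  exists (Num.bound e^-1); set n := Num.bound _.
  have en : e^-1 < n%:R by apply: archi_boundP; rewrite invr_ge0 ltW.
  have : (5 ^+ n)^-1 < e.
    rewrite -[ltRHS]invrK ltf_pV2 ?posrE ?invr_gt0 ?exprn_gt0//.
    by apply: lt_trans en _; rewrite -natrX ltr_nat ltn_expl.
  by rewrite exprS invfM; lra.
have cP : continuous (P n.+1).
  rewrite /P; elim: (n) => [|k IH].
    by under eq_fun do rewrite big_geq//; move=> y; exact: cvg_cst.
  under eq_fun do rewrite big_nat_recr//=.
  apply: continuous_addfun => //; apply: continuous_scalefun.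
  by under eq_fun do rewrite -[X in cos X]addr0; exact: continuous_cosM.
have /cvgrPdist_lt/(_ (e / 4)) := cP x.
have e40 : 0 < e / 4 by rewrite divr_gt0.
move=> /(_ e40); apply: filterS => y Pxy.
have := weierstrass_tail n.+1 x isT; have := weierstrass_tail n.+1 y isT.
rewrite -[W x - W y](_ : W x - P n.+1 x + (P n.+1 x - P n.+1 y)
  - (W y - P n.+1 y) = _); last by ring.
move=> ? ?.
apply: le_lt_trans (ler_normB _ _) _.
have := ler_normD (W x - P n.+1 x) (P n.+1 x - P n.+1 y).
lra.
Qed.

(** For the modes [m <= n], the linear Taylor terms sum to [h] times the sine sum, and the errors
    [5 ^+ m * h ^+ 2 / 2] to at most [5 / 8 * h]. The modes beyond [n] cost [h / 4] at each of the
    two points, for a total of [9 / 8 * h]. *)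
Lemma weierstrass_backward_increment n x (h := (5 ^+ n)^-1 : R) :
  h * lacunary_sum 1 (fun i => b i.+1) n x - 9 / 8 * h <= W (x - h) - W x.
Proof.
have h0 : 0 < h by exact: pow5V_gt0.
have PE : h * lacunary_sum 1 (fun i => b i.+1) n x - 5 / 8 * h
  <= P n.+1 (x - h) - P n.+1 x.
  rewrite /P -sumrB big_add1/= big_mkord /lacunary_sum mulr_sumr.
  have geom : \sum_(i < n) 5 ^+ i.+1 <= 5 / 4 * 5 ^+ n :> R.
    elim: (n) => [|k IH]; first by rewrite big_ord0 mulr_ge0.
    by rewrite big_ord_recr/= exprS; lra.
  apply: (@le_trans _ _ (\sum_(i < n) (h * (b i.+1 *
       sin ((5 ^ i.+1)%N%:R * 1 * x)) - 5 ^+ i.+1 * (h ^+ 2 / 2)))).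
    rewrite sumrB -mulr_suml lerD2l lerN2.
    have := ler_wpM2r (_ : 0 <= h ^+ 2 / 2) geom.
    have -> : 5 / 4 * 5 ^+ n * (h ^+ 2 / 2) = 5 / 8 * h.
      by rewrite /h; field; rewrite expf_neq0.
    by apply; rewrite mulr_ge0// exprn_ge0// ltW.
  apply: ler_sum => i _.
  rewrite mulr1 natrX.
  set p := 5 ^+ i.+1.
  have p0 : 0 < p by exact: exprn_gt0.
  have /andP[bi0 bi1] := b01 i.+1.
  have := @cos_taylor2 (p * x) (p * h) (mulr_ge0 (ltW p0) (ltW h0)).
  rewrite -mulrBr -mulrBr => tay.
  have : p^-1 * b i.+1 * (p * h * sin (p * x) - (p * h) ^+ 2 / 2) <=
    p^-1 * b i.+1 * (cos (p * (x - h)) - cos (p * x)).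
    by apply: ler_wpM2l; [rewrite mulr_ge0// invr_ge0 ltW|lra].
  apply: le_trans.
  rewrite (_ : p^-1 * b i.+1 * _ =
    h * (b i.+1 * sin (p * x)) - b i.+1 * (p * (h ^+ 2 / 2))); last first.
    by field; rewrite gt_eqF.
  rewrite lerD2l lerN2 ler_piMl// mulr_ge0 ?(ltW p0)//.
  by rewrite mulr_ge0// sqr_ge0.
have := weierstrass_tail n.+1 x isT.
have := weierstrass_tail n.+1 (x - h) isT.
have -> : 5 / 4 * (5 ^+ n.+1)^-1 = h / 4.
  by rewrite /h exprS; field; rewrite expf_neq0.
rewrite !ler_norml => /andP[? ?] /andP[? ?].
lra.
Qed.

End weierstrass_function.

(** * Record points, their image, and Hausdorff measure *)

Section records.
Context {R : realType}.
Local Notation mu := (@lebesgue_measure R).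

(** The left endpoint, vacuously a record, is excluded by [p < x]; this leaves room for small
    backward steps inside the interval. *)
Definition records (f : R -> R) (p q : R) : set R :=
  [set x | p < x <= q /\ forall t, p <= t < x -> f t < f x].

Lemma itv_sub_image_records (f : R -> R) p q : continuous f -> p <= q ->
  `]f p, f q] `<=` f @` records f p q.
Proof.
move=> cf pq y /=; rewrite in_itv/= => /andP[py yq].
(* The first point where [f] reaches [y] is the minimum [c] of this compact set. *)
pose A := `[p, q] `&` f @^-1` [set` `[y, +oo[].
have [c /set_mem[/= + yc] cmin] : exists2 c, c \in A & forall t, t \in A -> c <= t.
  apply: (@compact_EVT_min R R id A).
  - exists q; split; rewrite /= in_itv/= ?lexx ?pq//.
    by rewrite yq.
  - apply: (subclosed_compact _ (@segment_compact R p q)) => [|? []//].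
    apply: closedI; first exact: interval_closed.
    by apply: closed_comp => [? _|]; [exact: cf|exact: interval_closed].
  - by apply: continuous_subspaceT => ?; exact: cvg_id.
rewrite in_itv/= => /andP[pc cq]; move: yc; rewrite in_itv/= andbT => yc.
have Ale t : p <= t <= q -> y <= f t -> c <= t.
  move=> ptq yt; apply: cmin; apply: mem_set.
  by split; rewrite /= in_itv/= ?ptq// yt.
(* The level [y] is attained at some [d <= c]; minimality of [c] forces [d = c], hence [f c = y]. *)
have [d /[!in_itv]/= /andP[pd dc] fd] : exists2 d, d \in `[p, c] & f d = y.
  apply: IVT => //; first exact: continuous_subspaceT.
  by rewrite ge_min (ltW py)/= le_max yc orbT.
have cd : c <= d by apply: Ale; rewrite ?fd// pd (le_trans dc).
have dcE : d = c by apply/eqP; rewrite eq_le dc.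
exists c; last by rewrite -dcE.
have fc : f c = y by rewrite -dcE.
split=> [|t /andP[pt tc]].
  by rewrite cq andbT lt_neqAle pc andbT; apply: contraTneq py => ->; rewrite fc ltxx.
rewrite fc ltNge; apply/negP => yt.
have : c <= t by apply: Ale => //; rewrite pt (le_trans (ltW tc)).
by rewrite leNgt tc.
Qed.

Lemma H1_negligible (E : set R) : mu.-negligible E -> H1 E = 0%E.
Proof.
move=> [B [mB B0 EB]]; apply/eqP; rewrite eq_le; apply/andP; split.
  by apply: ereal_inf_lbound; exists B.
by apply: le_ereal_inf_tmp => _ [B' [mB' _] <-]; exact: measure_ge0.
Qed.

Lemma H1_gt0 (F : set R) (u v : R) : u < v -> `]u, v] `<=` F -> (0 < H1 F)%E.
Proof.
move=> uv uvF; apply: (@lt_le_trans _ _ (v - u)%:E); first by rewrite lte_fin subr_gt0.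
apply: le_ereal_inf_tmp => _ [B [mB FB] <-].
have <- : mu `]u, v] = (v - u)%:E by rewrite lebesgue_measure_itv/= lte_fin uv.
by apply: le_measure; rewrite ?inE//; apply: subset_trans FB.
Qed.

End records.

(** * Records of the Gaussian-weighted Weierstrass function *)

Section gaussian_weierstrass.
Context {R : realType}.
Local Notation mu := (@lebesgue_measure R).
Variable b : nat -> R.
Hypothesis b01 : forall m, 0 <= b m <= 1.
Let f x := expR (- x ^+ 2) * weierstrass b x.

Lemma continuous_gaussian_weierstrass : continuous f.
Proof.
apply: continuous_mulfun; last exact: continuous_weierstrass.
move=> x; apply: continuous_comp; last exact: continuous_expR.
by apply: cvgN; exact: exprn_continuous.
Qed.

Lemma record_lacunary_sum_le n x : -1 <= x <= 0 ->
  -1 <= x - (5 ^+ n)^-1 -> f (x - (5 ^+ n)^-1) < f x ->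
  lacunary_sum 1 (fun i => b i.+1) n x <= 2.
Proof.
move=> /andP[x1 x0]; set h := (5 ^+ n)^-1 => xh.
have h0 : 0 < h by rewrite invr_gt0 exprn_gt0.
set t := x - h => ftx.
(* The change in the Gaussian exponent: [u = h * (- t - x)] lies between 0 and [2 * h] because [t]
   and [x] are in [[-1, 0]]. *)
pose u := t ^+ 2 - x ^+ 2.
have u0 : 0 <= u by rewrite /u /t; nra.
have uh : u <= 2 * h by rewrite /u /t; nra.
have Wtx : expR (- u) * weierstrass b t < weierstrass b x.
  have ex0 : 0 < expR (- x ^+ 2) by exact: expR_gt0.
  rewrite -(ltr_pM2l ex0) mulrA -expRD.
  by rewrite (_ : - x ^+ 2 + - u = - t ^+ 2); [exact: ftx|rewrite /u; ring].
have := weierstrass_backward_increment b b01 n x; rewrite -/h -/t /=.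
have := weierstrass_le14 b b01 t; rewrite ler_norml => /andP[Wt1 Wt2].
have e1 : expR (- u) <= 1 by rewrite expR_le1 oppr_le0.
have e2 : 1 - u <= expR (- u) by exact: expR_ge1Dx.
move: (weierstrass b t) (weierstrass b x) (lacunary_sum _ _ _ _) (expR _)
  Wt1 Wt2 e1 e2 Wtx => Wt Wx S e Wt1 Wt2 e1 e2 Wtx inc.
(* Since [Wt <= 1 / 4] and [1 - e <= u <= 2 * h], the weight accounts for at most [h / 2]; adding
   the [9 / 8 * h] of the increment bound gives [S <= 13 / 8]. *)
have : Wt - Wx <= h / 2.
  have : (1 - e) * (4^-1 - Wt) >= 0 by rewrite mulr_ge0 ?subr_ge0.
  lra.
move=> d; rewrite -(ler_pM2l h0); lra.
Qed.

(** The index from which [x - 5 ^- n] stays in [[-1, x[] depends on the record [x], hence the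
    countable union over thresholds [k]. *)
Lemma records_negligible : ~ cvgn (series (fun i => b i.+1 ^+ 2)) ->
  mu.-negligible (records f (-1) 0).
Proof.
move=> dvg.
pose A k := [set x | forall n, (k <= n)%N ->
  lacunary_sum 1 (fun i => b i.+1) n x <= 2].
apply: (@negligibleS _ _ _ mu (\bigcup_k A k)); last first.
  apply: negligible_bigcup => k.
  exact: lacunary_bounded_above_negligible.
move=> x [/andP[x1 x0] rec].
have y0 : 0 < x + 1 by lra.
pose k := Num.bound (x + 1)^-1; exists k => // n kn.
have h0 : 0 < (5 ^+ n)^-1 :> R by rewrite invr_gt0 exprn_gt0.
have hy : (5 ^+ n)^-1 <= x + 1.
  rewrite -[leRHS]invrK lef_pV2 ?posrE ?invr_gt0 ?exprn_gt0//.
  apply/ltW/(lt_trans (archi_boundP _)); first by rewrite invr_ge0 ltW.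
  by rewrite -natrX ltr_nat (leq_ltn_trans kn)// ltn_expl.
apply: record_lacunary_sum_le; [by lra|by lra|].
by apply: rec; apply/andP; split; lra.
Qed.

(** The first mode and the tail bound give [f 0 >= 1 / 5 - 1 / 20 = 3 / 20], while
    [f (-1) <= 1 / 2 * 1 / 4 = 1 / 8]. *)
Lemma gaussian_weierstrass_lt : b 1 = 1 -> f (-1) < f 0.
Proof.
move=> b1.
have P2 x : weierstrass_sum b 2 x = cos (5 * x) / 5.
  by rewrite /weierstrass_sum big_nat1 b1 expr1; ring.
have := weierstrass_tail b b01 2 0 isT.
have := weierstrass_le14 b b01 (-1).
rewrite P2 mulr0 cos0 !ler_norml => /andP[_ Wm] /andP[W0 _].
rewrite /f expr0n/= oppr0 expR0 mul1r sqrrN expr1n.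
have e0 : 0 < expR (-1) :> R by exact: expR_gt0.
have e2 : expR (-1) <= 2^-1 :> R.
  rewrite expRN lef_pV2 ?posrE ?expR_gt0//.
  by have := expR_ge1Dx (1 : R); lra.
nra.
Qed.

End gaussian_weierstrass.

(** * The coefficients [m ^ (- sigma)] and the conclusion *)

Lemma powR_harmonic_dvg (R : realType) (sigma : R) : sigma < 2^-1 ->
  ~ cvgn (series (fun i => (i.+1%:R `^ (- sigma)) ^+ 2)).
Proof.
move=> s2 cv; apply: (@dvg_harmonic R); apply: series_le_cvg cv => n.
- exact: harmonic_ge0.
- exact: sqr_ge0.
(* The exponent [- 2 * sigma] exceeds -1 and the base [n.+1] is at least 1, so the squares dominate
   the harmonic terms. *)
rewrite -powR_mulrn ?powR_ge0// -powRrM /= -[leLHS]powR_inv1 ?ler0n//.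
by apply: ler_powR; [rewrite ler1n|lra].
Qed.

Theorem theorem1p7 (R : realType) (sigma : R) :
  3^-1 < sigma -> sigma < 2^-1 ->
  exists E : set R, H1 E = 0%E /\ (0 < H1 (f_sigma sigma @` E))%E.
Proof.
move=> s3 s2.
have s0 : 0 < sigma by apply: lt_trans s3; rewrite invr_gt0.
pose b (m : nat) : R := m%:R `^ (- sigma).
have b01 m : 0 <= b m <= 1.
  (* At [m = 0] the power of 0 with nonzero exponent is 0 by convention, so [b 0 = 0]. *)
  rewrite powR_ge0/=; case: m => [|m]; first by rewrite /b powR0// oppr_eq0 gt_eqF.
  by rewrite /b -[leRHS](powRr0 m.+1%:R) ler_powR// ?ler1n// oppr_le0 ltW.
have -> : f_sigma sigma = fun x => expR (- x ^+ 2) * weierstrass b x by [].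
exists (records (fun x => expR (- x ^+ 2) * weierstrass b x) (-1) 0); split.
  apply: H1_negligible.
  exact: (records_negligible b b01 (powR_harmonic_dvg _ _ s2)).
apply: H1_gt0 (itv_sub_image_records _ _ _ _ _).
- by apply: (gaussian_weierstrass_lt b b01); rewrite /b powR1.
- exact: (continuous_gaussian_weierstrass b b01).
- by rewrite oppr_le0.
Qed.
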